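(* Let $V$ be a finite-dimensional complex vector space and $F\colon V\to\mathbb{R}$ a function such that for every $r\in\mathbb{R}$ the set $\{T\in V:F(T)\le r\}$ is Zariski-closed. Let $X\subseteq V$ be non-empty, Zariski-closed and irreducible, and let $F[X]=\sup_{T\in X}F(T)$. Then the set $\{T\in X:F(T)=F[X]\}$ is Zariski-dense in $X$. In particular it is non-empty and $F[X]<\infty$. *)

(* Defs.v *)
From HB Require Import structures.
From mathcomp Require Import all_boot all_order all_algebra.
From mathcomp Require Import all_classical all_reals all_analysis.
From mathcomp Require Import complex.
(* The notations of mpoly clash with those of MathComp-Analysis. *)
From mathcomp Require Import -(notations) mpoly.

Set Implicit Arguments.
Unset Strict Implicit.
Unset Printing Implicit Defensive.

Import GRing.Theory.

Local Open Scope classical_set_scope.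
Local Open Scope ring_scope.

Section Zariski.
Context {K : fieldType} {V : vectType K}.

(* Polynomial functions are written in the coordinates of the basis
   [vbasis fullv]; a linear change of coordinates maps polynomials to
   polynomials, so the zero loci do not depend on this choice. *)
Definition poly_fun (p : mpoly (\dim {:V}) K) (v : V) : K :=
  meval (fun i => coord (vbasis fullv) i v) p.

Definition zero_locus (S : set (mpoly (\dim {:V}) K)) : set V :=
  [set v | forall p, S p -> poly_fun p v = 0].

Definition zariski_open (U : set V) : Prop :=
  exists S, U = ~` zero_locus S.

Lemma zariski_openT : zariski_open setT.
Proof.
exists (eq (1 : mpoly (\dim {:V}) K)); rewrite -setC0; congr (~` _).
apply/esym; rewrite -subset0 => v /(_ 1 erefl).
by rewrite /poly_fun meval1 => /eqP; rewrite oner_eq0.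
Qed.

Lemma zariski_openI : setI_closed zariski_open.
Proof.
move=> _ _ [S ->] [S' ->].
exists [set q : mpoly (\dim {:V}) K | exists p p', [/\ S p, S' p' & q = p * p']].
rewrite -setCU; congr (~` _); apply/seteqP; split=> v.
  by case=> Hv _ [p [p' [Sp Sp' ->]]]; rewrite /poly_fun mevalM;
    [rewrite [X in X * _](Hv p Sp) mul0r | rewrite [X in _ * X](Hv p' Sp') mulr0].
move=> Hv; apply: contrapT => /not_orP[/existsNP[p /not_implyP[Sp np]]].
move=> /existsNP[p' /not_implyP[Sp' np']].
have /eqP := Hv _ (ex_intro _ p (ex_intro _ p' (And3 Sp Sp' erefl))).
by rewrite /poly_fun mevalM mulf_eq0 => /orP[] /eqP.
Qed.

Lemma zariski_open_bigU (J : Type) (f : J -> set V) :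
  (forall i, zariski_open (f i)) -> zariski_open (\bigcup_i f i).
Proof.
move=> /choice[S fS]; exists (\bigcup_i S i).
rewrite -[LHS]setCK setC_bigcup; congr (~` _); apply/seteqP; split=> v.
  by move=> Hv p [i _ Sp]; have := Hv i I; rewrite fS setCK; apply.
by move=> Hv i _; rewrite fS setCK => p Sp; apply: Hv; exists i.
Qed.

End Zariski.

(* An alias, so that the Zariski topology is not attached to [V] itself. *)
Definition zariski {K : fieldType} (V : vectType K) : Type := V.

HB.instance Definition _ (K : fieldType) (V : vectType K) :=
  Choice.on (zariski V).
HB.instance Definition _ (K : fieldType) (V : vectType K) :=
  isOpenTopological.Build (zariski V)
    (@zariski_openT K V) (@zariski_openI K V) (@zariski_open_bigU K V).

Lemma zariski_closedP (K : fieldType) (V : vectType K) (X : set (zariski V)) :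
  closed X <-> exists S, X = zero_locus S.
Proof.
rewrite -openC; split=> [[S /(congr1 setC)]|[S ->]]; last by exists S.
by rewrite !setCK; exists S.
Qed.

(* The relatively closed subsets of [X] are the [X `&` A] with [A] closed; so
   [X] is not the union of two proper relatively closed subsets. *)
Definition irreducible {T : topologicalType} (X : set T) : Prop :=
  X !=set0 /\
  forall A B : set T, closed A -> closed B -> X `<=` A `|` B ->
    X `<=` A \/ X `<=` B.

Definition dense_in {T : topologicalType} (D X : set T) : Prop :=
  D `<=` X /\ X `<=` closure D.

Definition sup_on {R : realType} {T : Type} (F : T -> R) (X : set T) : \bar R :=
  ereal_sup [set (F t)%:E | t in X].

(* Main.v *)
(* An irreducible complex variety contained in a countable union of closed sets
   is contained in one of them.  If [D] were contained in a closed [A] with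
   [X] not in [A], this would contradict that [X] is covered by [A] and the sets
   [F <= r n], where [r n < sup F] is cofinal.

   The covering statement is a Nullstellensatz: a point of [X] is wanted at which
   countably many polynomials outside the prime ideal of [X] do not vanish.  Starting
   from the ideal of [X], adjoin [x_i - c_i] for one coordinate at a time, keeping
   the ideal disjoint from the products of these polynomials.  A suitable [c_i]
   exists because [K] is uncountable and algebraically closed while the
   polynomial ring has countable dimension. *)
Require Import Defs.
From mathcomp Require Import all_boot all_order all_algebra.
From mathcomp Require Import all_classical all_reals all_analysis.
From mathcomp Require Import complex.
From mathcomp Require Import ring.
From mathcomp Require Import -(notations) mpoly.

Set Implicit Arguments.
Unset Strict Implicit.
Unset Printing Implicit Defensive.

Import Order.TTheory GRing.Theory Num.Theory.

Local Open Scope classical_set_scope.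
Local Open Scope ring_scope.

(** * Uncountability and a linear relation *)

Lemma realType_uncountable (R : realType) : ~ countable [set: R].
Proof.
move=> /(sub_countable (subset_card_le (@subsetT _ `[0%R, 1%R]%classic))).
move=> /countable_lebesgue_measure0 /eqP.
by rewrite lebesgue_measure_itv /= lte_fin ltr01 oppr0 adde0 eqe oner_eq0.
Qed.

Lemma complex_uncountable (R : realType) : ~ countable [set: R[i]].
Proof.
move=> cC; apply: (@realType_uncountable R).
apply: sub_countable cC; rewrite (_ : [set: R] = @complex.Re R @` setT).
  exact: card_image_le.
by apply/seteqP; split=> // x _; exists (x%:C)%C.
Qed.

(** Pigeonhole: with finite fibres only, [T] would be a countable union of finite sets. *)
Lemma uncountable_fiber (T : Type) (c : T -> nat) : ~ countable [set: T] ->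
  exists2 u : nat -> T, injective u & forall i j, c (u i) = c (u j).
Proof.
move=> uT.
have [N /infiniteP/card_leP[f]] : exists N, infinite_set (c @^-1` [set N]).
  apply: contrapT => /forallNP fT; apply: uT.
  rewrite (_ : setT = \bigcup_N c @^-1` [set N]); last first.
    by apply/seteqP; split => // x _; exists (c x).
  apply: bigcup_countable => [|N _]; first exact: countableP.
  exact: finite_set_countable (contrapT (fT N)).
pose s k : [set: nat] := SigSub (mem_set (I : [set: nat] k)).
exists (fun k => set_val (f (s k))) => [i j /val_inj|i j].
  by move=> /(@inj _ _ _ f); rewrite !inE => /(_ I I) /(congr1 set_val).
have cN k : c (set_val (f (s k))) = N by exact: set_valP (f (s k)).
by rewrite !cN.
Qed.

Lemma linear_dependence (K : fieldType) (m : nat) (b : 'I_m.+1 -> 'I_m -> K) :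
  exists2 u : 'I_m.+1 -> K,
    (exists k, u k != 0) & forall i, \sum_k u k * b k i = 0.
Proof.
pose B := \matrix_(k, i) b k i.
have : kermx B != 0.
  rewrite kermx_eq0 /row_free neq_ltn; apply/orP; left.
  exact: leq_ltn_trans (rank_leq_col B) _.
case/rowV0Pn => u /sub_kermxP uB u0.
exists (u 0).
  by apply: contrapT => /forallNP u0'; case/eqP: u0; apply/rowP => k;
    rewrite mxE; apply/eqP/negPn/negP => /u0'.
move=> i; have /matrixP/(_ 0 i) := uB; rewrite !mxE => uBi; rewrite -[RHS]uBi.
by apply: eq_bigr => k _; rewrite mxE.
Qed.

Section Ideals.
Context {A : comNzRingType}.
Implicit Types (J : set A) (x : A).

Definition ideal J : Prop :=
  [/\ J 0, forall a b, J a -> J b -> J (a + b) & forall a b, J b -> J (a * b)].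

(** For an ideal [J] this is [J + (x)]. *)
Definition ideal_adjoin J x : set A := [set a | exists g, J (a - x * g)].

Lemma ideal_adjoin_ideal J x : ideal J -> ideal (ideal_adjoin J x).
Proof.
case=> J0 JD JM; split.
- by exists 0; rewrite mulr0 subr0.
- move=> a b [g Jg] [h Jh]; exists (g + h).
  by rewrite mulrDr opprD addrACA; apply: JD.
- by move=> a b [g Jg]; exists (a * g); rewrite mulrCA -mulrBr; apply: JM.
Qed.

Lemma sub_ideal_adjoin J x : J `<=` ideal_adjoin J x.
Proof. by move=> a Ja; exists 0; rewrite mulr0 subr0. Qed.

Lemma mem_ideal_adjoin J x : ideal J -> ideal_adjoin J x x.
Proof. by case=> J0 _ _; exists 1; rewrite mulr1 subrr. Qed.

End Ideals.

(** * Ideals avoiding a countable multiplicative set *)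

Section CountableDimension.
Context {K : closedFieldType} {A : comAlgType K}.
Implicit Types (J : set A) (x : A).

(* That is, [A] has countable dimension over [K]. *)
Context (e : nat -> seq A).
Hypothesis e_span : forall a, exists m (b : nat -> K),
  a = \sum_(i < size (e m)) b i *: (e m)`_i.

(* [h] encodes a countable multiplicative set: the divisors of the [h n] are
   closed under products, and an ideal meets this set iff it contains some [h n]. *)
Context (h : nat -> A).
Hypothesis h_mul : forall m n, exists t, h (m + n)%N = t * (h m * h n).

Definition avoids J : Prop := forall n, ~ J (h n).

Lemma split_meets J x (q : {poly K}) : ideal J -> q != 0 ->
  (forall c, ~ avoids (ideal_adjoin J (x - c%:A))) ->
  ~ avoids (ideal_adjoin J (horner_alg x q)).
Proof.
move=> [J0 JD JM] q0 meets; have [r ->] := closed_field_poly_normal q.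
rewrite -lead_coef_eq0 in q0; move: (lead_coef q) q0 => a a0.
suff [n [g Jg]] : exists n, ideal_adjoin J
    (horner_alg x (\prod_(z <- r) ('X - z%:P))) (h n).
  move=> /(_ n); apply; exists (a^-1 *: g).
  by rewrite linearZ /= mulr_algl -scalerAr -scalerAl scalerA mulVf // scale1r.
elim: r => [|z r [n [g Jg]]].
  by exists 0%N, (h 0%N); rewrite big_nil rmorph1 mul1r subrr.
have /existsNP[m /contrapT[g' Jg']] := meets z.
have [t ht] := h_mul m n; exists (m + n)%N, (t * (g' * g)).
rewrite big_cons rmorphM rmorphB /= horner_algX horner_algC ht.
set p := horner_alg _ _ in Jg *; set y := x - _ in Jg' *.
rewrite (_ : _ - _ = t * (h n * (h m - y * g')) + t * (y * g' * (h n - p * g)));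
  last by ring.
by apply: JD; apply/JM/JM.
Qed.

Hypothesis K_uncountable : ~ countable [set: K].

(* If no [c] works, then [h n = (x - c) g c] modulo [J] for infinitely many [c]
   with the same [n] and with the [g c] in one finite dimensional space.  A linear
   relation between the [g c], multiplied by the product of the [x - c],
   gives [q(x) * h n = 0] modulo [J] for some polynomial [q <> 0]. *)
Lemma exists_avoiding_adjoin J x : ideal J -> avoids J ->
  exists c, avoids (ideal_adjoin J (x - c%:A)).
Proof.
move=> Jid Jh; have [J0 JD JM] := Jid; apply: contrapT => /forallNP meets.
have /choice[w wP] : forall c, exists w : nat * nat, exists b : nat -> K,
    J (h w.1 - (x - c%:A) * \sum_(i < size (e w.2)) b i *: (e w.2)`_i).
  move=> c; have /existsNP[n /contrapT[g Jg]] := meets c.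
  have [m [b gE]] := e_span g.
  by exists (n, m), b; rewrite -gE.
(* Coding both indices by one number makes them constant together along [c]. *)
have [c c_inj cE] := uncountable_fiber (pickle \o w) K_uncountable.
have [n [m cP]] : exists n m, forall k, exists b : nat -> K,
    J (h n - (x - (c k)%:A) * \sum_(i < size (e m)) b i *: (e m)`_i).
  exists (w (c 0%N)).1, (w (c 0%N)).2 => k.
  by rewrite (pcan_inj pickleK (cE 0%N k)).
have {cP} /choice[b bP] := cP; move: (size (e m)) bP => M bP.
have [u [k0 uk0] ub] := linear_dependence (fun (k : 'I_M.+1) (i : 'I_M) => b k i).
pose P k := \prod_(l < M.+1 | l != k) ('X - (c l)%:P).
pose q := \sum_(k < M.+1) u k *: P k.
(* Evaluate at [c k0]: every other [P k] has the factor ['X - c k0], while [P k0] does not vanish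
   there because [c] is injective. *)
have q0 : q != 0.
  apply: contraNneq uk0 => /(congr1 (fun p => p.[c k0])).
  rewrite horner0 horner_sum (bigD1 k0) //= big1 ?addr0 => [|k kk0].
    rewrite hornerZ horner_prod => /eqP; rewrite mulf_eq0 => /orP[//|].
    rewrite prodf_seq_eq0 => /hasP[l _ /andP[lk]].
    by rewrite hornerXsubC subr_eq0 => /eqP/c_inj/ord_inj/esym/eqP; rewrite (negPf lk).
  rewrite hornerZ horner_prod (bigD1 k0) 1?eq_sym //=.
  by rewrite hornerXsubC subrr mul0r mulr0.
have := split_meets Jid q0 meets; apply => m' [p Jp].
have Jq : J (horner_alg x q * h n).
  rewrite (_ : _ * _ = \sum_k u k *: (horner_alg x (P k)) *
     (h n - (x - (c k)%:A) * \sum_(i < M) b k i *: (e m)`_i)).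
    by elim/big_ind: _ => // k _; apply/JM/bP.
  under eq_bigr do rewrite mulrBr.
  rewrite sumrB -mulr_suml -[LHS]subr0 /q linear_sum; congr (_ * _ - _).
    by apply: eq_bigr => k _; rewrite linearZ /= mulr_algl.
  (* Each [P k] times its missing factor is the same [Q], so the subtracted sum is killed by the
     relation [ub]. *)
  pose Q := horner_alg x (\prod_(l < M.+1) ('X - (c l)%:P)).
  transitivity (\sum_k \sum_(i < M) (u k * b k i) *: (Q * (e m)`_i)).
    rewrite exchange_big big1 // => i _ /=.
    by rewrite -scaler_suml ub scale0r.
  apply: eq_bigr => k _.
  have -> : Q = horner_alg x (P k) * (x - (c k)%:A).
    rewrite /Q (bigD1 k) //= rmorphM rmorphB /= horner_algX horner_algC.
    by rewrite mulrC.
  rewrite mulrA -!scalerAl mulr_sumr scaler_sumr; apply: eq_bigr => i _.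
  by rewrite -scalerAr scalerA.
have [t ht] := h_mul m' n; apply: (Jh (m' + n)%N); rewrite ht.
rewrite (_ : _ * _ = t * (h n * (h m' - horner_alg x q * p))
  + t * (p * (horner_alg x q * h n))); last by ring.
by apply: JD; apply/JM/JM.
Qed.

Lemma exists_avoiding_adjoin_seq J (s : seq A) : ideal J -> avoids J ->
  exists J', [/\ ideal J', avoids J', J `<=` J' &
    forall x, x \in s -> exists c : K, J' (x - c%:A)].
Proof.
move=> Jid Jh; elim: s => [|x s [J' [J'id J'h JJ' sJ']]].
  by exists J; split => // x; rewrite in_nil.
have [c cP] := exists_avoiding_adjoin x J'id J'h.
exists (ideal_adjoin J' (x - c%:A)); split => //.
- exact: ideal_adjoin_ideal.
- by apply: subset_trans JJ' _; apply: sub_ideal_adjoin.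
- move=> y; rewrite inE => /predU1P[->|/sJ'[d Jd]].
    by exists c; apply: mem_ideal_adjoin.
  by exists d; apply: sub_ideal_adjoin.
Qed.

End CountableDimension.

(** * Polynomial rings and their points *)

Lemma mpoly_countable_dim (n : nat) (K : fieldType) (p : mpoly n K) :
  let e k := map (@mpolyX n K) (odflt [::] (unpickle k)) in
  exists m (b : nat -> K), p = \sum_(i < size (e m)) b i *: (e m)`_i.
Proof.
move=> e; exists (pickle (msupp p)), (fun i => mcoeff (nth mnm0 (msupp p) i) p).
rewrite /e pickleK /= size_map {1}(mpolyE p) (big_nth mnm0) big_mkord.
by apply: eq_bigr => i _; rewrite (nth_map mnm0).
Qed.

(** Being congruent to one's value modulo [J] passes to products and linear combinations, so the
    variables suffice. *)
Lemma ideal_sub_meval (n : nat) (K : fieldType) (J : set (mpoly n K))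
    (v : 'I_n -> K) (p : mpoly n K) :
  ideal J -> (forall i, J (mpolyX K (mnm1 i) - (v i)%:A)) -> J (p - (meval v p)%:A).
Proof.
move=> [J0 JD JM] Jv.
have Jprod q r : J (q - (meval v q)%:A) -> J (r - (meval v r)%:A) ->
    J (q * r - (meval v (q * r))%:A).
  move=> Jq Jr; rewrite mevalM.
  rewrite (_ : _ - _ = r * (q - (meval v q)%:A) + (meval v q)%:A * (r - (meval v r)%:A)).
    by apply: JD; apply: JM.
  by rewrite -scalerA -!mul_mpolyC !mulr1; ring.
elim/mpolyind: p => [|c m p _ _ Jp]; first by rewrite meval0 scale0r subrr.
rewrite mevalD mevalZ scalerDl opprD addrACA -scalerA -scalerBr.
apply: (JD) => //; rewrite -mul_mpolyC; apply: JM.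
rewrite (mpolyXE_id K m); elim/big_ind: _ => //.
- by rewrite meval1 scale1r subrr.
- move=> i _; elim: (m i) => [|k IH]; first by rewrite expr0 meval1 scale1r subrr.
  by rewrite exprS; apply: Jprod => //; rewrite mevalXU.
Qed.

(* For uncountable [K], the Nullstellensatz survives the inversion of countably
   many polynomials. *)
Lemma uncountable_nullstellensatz (n : nat) (K : closedFieldType)
    (J : set (mpoly n K)) (h : nat -> mpoly n K) :
  ~ countable [set: K] -> ideal J ->
  (forall k l, exists t, h (k + l)%N = t * (h k * h l)) -> avoids h J ->
  exists v : 'I_n -> K,
    (forall p, J p -> meval v p = 0) /\ (forall k, meval v (h k) != 0).
Proof.
move=> K_unc Jid h_mul Jh.
have [J' [J'id J'h JJ' J'X]] := exists_avoiding_adjoin_seq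
  (@mpoly_countable_dim n K) h_mul K_unc
  (map (fun i : 'I_n => mpolyX K (mnm1 i)) (enum 'I_n)) Jid Jh.
have /choice[v vP] : forall i : 'I_n, exists c : K, J' (mpolyX K (mnm1 i) - c%:A).
  by move=> i; apply: J'X; apply/map_f; rewrite mem_enum.
have [J'0 J'D J'M] := J'id.
have J'v p : J' (p - (meval v p)%:A) by exact: ideal_sub_meval.
exists v; split=> [p /JJ' Jp|k]; apply/eqP; last first.
  by move=> hk0; apply: (J'h k); have := J'v (h k); rewrite hk0 scale0r subr0.
(* A nonzero value would put a unit in [J'], hence also [h 0]. *)
apply: contrapT => /negP pv0; apply: (J'h 0%N).
have J'pv : J' (meval v p)%:A.
  rewrite (_ : _%:A = p + -1 * (p - (meval v p)%:A)); last by ring.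
  by apply/J'D/J'M.
rewrite (_ : h 0%N = (meval v p)^-1 *: h 0%N * (meval v p)%:A); first exact: J'M.
by rewrite -scalerAl -scalerAr mulr1 scalerA mulVf // scale1r.
Qed.

(** * Countable covers of irreducible closed sets *)

Section ZariskiClosed.
Context {K : closedFieldType} {V : vectType K}.
Hypothesis K_uncountable : ~ countable [set: K].

Definition vanishing_ideal (X : set V) : set (mpoly (\dim {:V}) K) :=
  [set p | forall v, X v -> poly_fun p v = 0].

Lemma vanishing_ideal_ideal (X : set V) : ideal (vanishing_ideal X).
Proof.
split=> [v _|a b Ia Ib v Xv|a b Ib v Xv].
- by rewrite /poly_fun meval0.
- by rewrite /poly_fun mevalD [X in X + _]Ia // [X in _ + X]Ib // addr0.
- by rewrite /poly_fun mevalM [X in _ * X]Ib // mulr0.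
Qed.

Lemma zero_locus_closed (S : set (mpoly (\dim {:V}) K)) :
  closed (zero_locus S : set (zariski V)).
Proof. by apply/zariski_closedP; exists S. Qed.

(** The zero loci of [p] and [q] together cover [X]. *)
Lemma vanishing_ideal_prime (X : set (zariski V)) p q : irreducible X ->
  vanishing_ideal X (p * q) -> vanishing_ideal X p \/ vanishing_ideal X q.
Proof.
move=> [_ Xirr] Ipq.
have := Xirr _ _ (@zero_locus_closed [set p]) (@zero_locus_closed [set q]).
case.
- move=> v Xv; have := Ipq v Xv; rewrite /poly_fun mevalM => /eqP.
  by rewrite mulf_eq0 => /orP[] /eqP pv; [left|right] => _ ->.
- by move=> Xp; left=> v /Xp; apply.
- by move=> Xq; right=> v /Xq; apply.
Qed.

Lemma poly_fun_surj (c : 'I_(\dim {:V}) -> K) :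
  exists v : V, forall p, poly_fun p v = meval c p.
Proof.
exists (\sum_i c i *: (vbasis {:V})`_i) => p.
apply: meval_eq => i; apply: coord_sum_free; exact: basis_free (vbasisP _).
Qed.

(** Pick [f k] vanishing on [Z k] but not on all of [X]; a point of [X] where no [f k] vanishes lies
    in no [Z k]. *)
Lemma irreducible_sub_bigcup_closed (X : set (zariski V))
    (Z : nat -> set (zariski V)) :
  irreducible X -> closed X -> (forall k, closed (Z k)) ->
  X `<=` \bigcup_k Z k -> exists k, X `<=` Z k.
Proof.
move=> Xirr /zariski_closedP[S XS] Zcl XZ; apply: contrapT => /forallNP XnZ.
have /choice[f fP] : forall k, exists f, ~ vanishing_ideal X f /\
    forall v, Z k v -> poly_fun f v = 0.
  move=> k; have [T ZT] := (zariski_closedP _).1 (Zcl k).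
  have /existsNP[v /not_implyP[Xv]] := XnZ k.
  rewrite ZT => /existsNP[f /not_implyP[Tf fv]]; exists f; split=> [/(_ v Xv)//|w].
  by apply.
have IN := vanishing_ideal_prime Xirr.
(* The exponent serves [h_mul]: [g k] and [g l] divide [g (k + l)], so [g k ^+ k * g l ^+ l] divides
   its power [k + l]. *)
pose g k := \prod_(i < k) f i; pose h k := g k ^+ k.
have I1 : ~ vanishing_ideal X 1.
  by have [[v Xv] _] := Xirr => /(_ v Xv) /eqP; rewrite /poly_fun meval1 oner_eq0.
have Ig k : ~ vanishing_ideal X (g k).
  rewrite /g; elim: k => [|k IH]; rewrite ?big_ord0// big_ord_recr /=.
  by move=> /IN[//|]; have [] := fP k.
have Ih k : ~ vanishing_ideal X (h k).
  rewrite /h; elim: {2}k => [|j IH]; rewrite ?expr0// exprS.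
  by move=> /IN[/Ig|].
have gD k l : exists t, g (k + l)%N = t * g k.
  by exists (\prod_(i < l) f (k + i)%N); rewrite mulrC /g big_split_ord.
have h_mul k l : exists t, h (k + l)%N = t * (h k * h l).
  have [[t gt] [t' gt']] := (gD k l, gD l k); rewrite addnC in gt'.
  exists (t ^+ k * t' ^+ l); rewrite /h exprD {1}gt gt' !exprMn; ring.
have [c [cI ch]] := uncountable_nullstellensatz K_uncountable
  (vanishing_ideal_ideal X) h_mul Ih.
have [v vc] := poly_fun_surj c.
have Xv : X v by rewrite XS => p Sp; rewrite vc cI // => w; rewrite XS; apply.
have [k _ Zv] := XZ v Xv; have /eqP := ch k.+1; apply.
rewrite /h /g big_ord_recr /= exprS !mevalM -!vc.
by have [_ ->] := fP k; rewrite // mulr0 mul0r.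
Qed.

End ZariskiClosed.

(** * Density of the points attaining the supremum *)

Lemma exists_seq_below (R : realType) (s : \bar R) : (s != -oo)%E ->
  exists r : nat -> R, (forall n, (r n)%:E < s)%E /\
    forall x : R, (x%:E < s)%E -> exists n, x <= r n.
Proof.
case: s => [s| |] // _.
  exists (fun n => s - n.+1%:R^-1); split=> [n|x].
    by rewrite lte_fin ltrBlDr ltrDl invr_gt0.
  rewrite lte_fin => /ltr_add_invr[n].
  by exists n; rewrite lerBrDr ltW.
exists (fun n => n%:R); split=> [n|x _]; first exact: ltry.
by exists (Num.truncn x).+1; apply/ltW/truncnS_gt.
Qed.

Theorem theorem4p3 (R : realType) (V : vectType R[i]) (F : V -> R)
  (F_closed : forall r : R, closed [set T : zariski V | F T <= r])
  (X : set (zariski V)) (X_neq0 : X !=set0) (X_closed : closed X)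
  (X_irreducible : irreducible X) :
  let D := [set T : zariski V | X T /\ (F T)%:E = sup_on F X] in
  [/\ dense_in D X, D !=set0 & (sup_on F X < +oo)%E].
Proof.
move=> D.
have F_le T : X T -> ((F T)%:E <= sup_on F X)%E.
  by move=> XT; apply: ereal_sup_ubound; exists T.
have sup_gt : (sup_on F X != -oo)%E.
  by have [T /F_le] := X_neq0; apply: contraTneq => ->.
have [r [r_lt r_cof]] := exists_seq_below sup_gt.
have XD : X `<=` closure D.
  rewrite closureE => T XT A [A_closed DA]; apply: (_ : X `<=` A) XT => {T}.
  (* Index [0] stands for [A], which contains [D]; the others cover the points of [X] where [F] is
     below the supremum. *)
  pose Z k := if k is k'.+1 then [set T : zariski V | F T <= r k'] else A.
  have [||[//|k XZ]] := irreducible_sub_bigcup_closed (@complex_uncountable R)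
    (Z := Z) X_irreducible X_closed.
  - by case=> [|k]; [exact: A_closed | exact: F_closed].
  - move=> T XT; have := F_le T XT; rewrite le_eqVlt => /predU1P[FT|/r_cof[k Fk]].
      by exists 0%N => //; apply: DA.
    by exists k.+1.
  have := r_lt k; rewrite ltNge => /negP[]; apply: ge_ereal_sup => _ [T XT <-].
  by rewrite lee_fin; apply: XZ.
have D_neq0 : D !=set0.
  apply/set0P/negP => /eqP D0; have [T /XD] := X_neq0.
  by rewrite D0 closure0.
split=> //; first by split=> // T [].
(* The supremum is attained, so it is a real value of [F]. *)
by have [T [_ <-]] := D_neq0; apply: ltry.
Qed.
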